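(* Let $M$ be a monoid, $A$ a right $M$-act and $E$ the endomorphism monoid of $A$. The following statements hold: a) If $A$ is a $*$-act then $A$ is weak self-projective and $\mathcal{C}_A=\mathcal{G}_A$. b) If $A$ is indecomposable, weak self-projective and $\mathcal{C}_A=\mathcal{G}_A$, then $A$ is a $*$-act.
   Context: For a monoid $M$, $[M^{\mathrm{op}},\mathcal{S}et]$ is the category of right $M$-acts: sets $X$ with an action $X\times M\to X$ such that $(xm)m'=x(mm')$ and $x1=x$ (the empty act is allowed), with equivariant maps; $[X,X']$ denotes the set of morphisms. All subcategories are full and closed under isomorphisms. With $E=[A,A]$, $A$ is an $E$-$M$-biact, and there are functors $H_A:[M^{\mathrm{op}},\mathcal{S}et]\to[E^{\mathrm{op}},\mathcal{S}et]$, $H_A(X)=[A,X]$, and its left adjoint $T_A:[E^{\mathrm{op}},\mathcal{S}et]\to[M^{\mathrm{op}},\mathcal{S}et]$, $T_A(Y)=Y\otimes_E A$ (the quotient of $Y\times A$ by the equivalence relation generated by $(ye,a)\sim(y,ea)$). Let $\delta:T_A\circ H_A\to\mathbf{1}$ and $\eta:\mathbf{1}\to H_A\circ T_A$ be the counit and unit. $\mathcal{C}_A$ is the full subcategory of $[M^{\mathrm{op}},\mathcal{S}et]$ of those $X$ such that for every morphism $\epsilon:U\to V$ of $M$-acts with $H_A(\epsilon)$ an isomorphism, $[X,\epsilon]:[X,U]\to[X,V]$ is bijective. $\mathcal{G}_A=\{X\in[M^{\mathrm{op}},\mathcal{S}et]\mid\delta_X\text{ is an epimorphism}\}$, $\mathcal{G}^A=\{Y\in[E^{\mathrm{op}},\mathcal{S}et]\mid\eta_Y\text{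 is a monomorphism}\}$ and $\mathcal{S}^A=\{Y\in[E^{\mathrm{op}},\mathcal{S}et]\mid\eta_Y\text{ is an isomorphism}\}$. $A$ is a $*$-act if the adjoint pair induces mutually inverse equivalences $H_A:\mathcal{G}_A\rightleftarrows\mathcal{G}^A:T_A$ (i.e. $H_A$ and $T_A$ restrict to functors between these subcategories which are mutually quasi-inverse equivalences). $A$ is weak self-projective if $(H_A\circ T_A)(g)$ is an epimorphism whenever $g:U\to Y$ is an epimorphism in $[E^{\mathrm{op}},\mathcal{S}et]$ with $U\in\mathcal{S}^A$. $A$ is decomposable if there are two non-empty subacts $B,C\subseteq A$ with $A=B\cup C$ and $B\cap C=\emptyset$; otherwise $A$ is indecomposable.
   Formalization: Part b) is stated for non-empty A: the empty act is not decomposable, is weak self-projective and has C_A = G_A = {empty act}, but it is not a *-act, since G^A contains the empty act and the one-point act. *)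

(* Defs.v *)
From HB Require Import structures.
From Stdlib Require Import Relation_Operators.
From mathcomp Require Import all_boot.
From mathcomp Require Import boolp classical_sets.

Set Implicit Arguments.
Unset Strict Implicit.
Unset Printing Implicit Defensive.

Declare Scope act_scope.
Delimit Scope act_scope with act.
Local Open Scope act_scope.

Record ract (M : monoidType) := RAct {
  carrier :> Type;
  act : carrier -> M -> carrier;
  actM : forall x m m', act (act x m) m' = act x (m * m')%g;
  act1 : forall x, act x 1%g = x }.

Notation "x *| m" := (act x m)
  (at level 40, left associativity) : act_scope.

Record hom (M : monoidType) (X Y : ract M) := Hom {
  hom_fun :> X -> Y;
  homM : forall x m, hom_fun (x *| m) = hom_fun x *| m }.

Lemma hom_eq (M : monoidType) (X Y : ract M) (f g : hom X Y) : f =1 g -> f = g.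
Proof.
case: f g => [f fM] [g gM] /= /funext fg; case: _ / fg gM => gM.
by congr Hom; exact: Prop_irrelevance.
Qed.

Definition hom_id (M : monoidType) (X : ract M) : hom X X :=
  @Hom M X X id (fun _ _ => erefl).

Definition hom_comp (M : monoidType) (X Y Z : ract M)
  (g : hom Y Z) (f : hom X Y) : hom X Z.
Proof. by exists (g \o f) => x m /=; rewrite !homM. Defined.

Section Morphisms.
Context (M : monoidType) (X Y : ract M).

Definition is_epi (f : hom X Y) : Prop :=
  forall (Z : ract M) (g h : hom Y Z),
    hom_comp g f = hom_comp h f -> g = h.

Definition is_mono (f : hom X Y) : Prop :=
  forall (Z : ract M) (g h : hom Z X),
    hom_comp f g = hom_comp f h -> g = h.

Definition is_iso (f : hom X Y) : Prop :=
  exists g : hom Y X, hom_comp g f = hom_id X /\ hom_comp f g = hom_id Y.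

End Morphisms.

Record functor (M N : monoidType) := Functor {
  fobj :> ract M -> ract N;
  fmap : forall X X' : ract M, hom X X' -> hom (fobj X) (fobj X');
  fmap_id : forall X, fmap (hom_id X) = hom_id (fobj X);
  fmap_comp : forall X X' X'' (g : hom X' X'') (f : hom X X'),
    fmap (hom_comp g f) = hom_comp (fmap g) (fmap f) }.
Arguments fmap {M N} _ {X X'} _.

Definition functor_id (M : monoidType) : functor M M :=
  @Functor M M id (fun _ _ f => f) (fun _ => erefl) (fun _ _ _ _ _ => erefl).

Definition functor_comp (M N K : monoidType)
  (G : functor N K) (F : functor M N) : functor M K.
Proof.
exists (fun X => G (F X)) (fun X X' f => fmap G (fmap F f)).
- by move=> X; rewrite !fmap_id.
- by move=> X X' X'' g f; rewrite !fmap_comp.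
Defined.

Record nat_trans (M N : monoidType) (F G : functor M N) := NatTrans {
  component :> forall X, hom (F X) (G X);
  naturality : forall X X' (f : hom X X'),
    hom_comp (component X') (fmap F f) = hom_comp (fmap G f) (component X) }.

(* A full subcategory is a predicate on acts, not an element of
   [set (ract M)]: that would force the universe of the carriers strictly below
   that of [choiceType], which [tensor] and monoids seen as acts exclude. *)

(* The restrictions of [F] and [G] to the full subcategory [P] are naturally
   isomorphic; the components are only required at the objects of [P]. *)
Definition nat_iso_on (M N : monoidType) (P : ract M -> Prop)
    (F G : functor M N) : Prop :=
  exists phi : forall X, P X -> hom (F X) (G X),
    (forall X (PX : P X), is_iso (phi X PX)) /\
    (forall X X' (PX : P X) (PX' : P X') (f : hom X X'),
       hom_comp (phi X' PX') (fmap F f) = hom_comp (fmap G f) (phi X PX)).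

(* [F] and [G] restrict to functors between the full subcategories [P] and [Q],
   and these restrictions are mutually quasi-inverse equivalences. *)
Definition quasi_inverse_on (M N : monoidType) (P : ract M -> Prop)
    (Q : ract N -> Prop) (F : functor M N) (G : functor N M) : Prop :=
  [/\ forall X, P X -> Q (F X),
      forall Y, Q Y -> P (G Y),
      nat_iso_on P (functor_comp G F) (functor_id M) &
      nat_iso_on Q (functor_comp F G) (functor_id N)].

Section EndomorphismMonoid.
Context (M : monoidType) (A : ract M).

Definition endo : Type := hom A A.

HB.instance Definition _ := gen_eqMixin endo.
HB.instance Definition _ := gen_choiceMixin endo.

Definition endo_mul (e e' : endo) : endo := hom_comp e e'.

Lemma endo_mulA : associative endo_mul.
Proof. by move=> e e' e''; exact: hom_eq. Qed.
Lemma endo_mul1 : left_id (hom_id A) endo_mul.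
Proof. by move=> e; exact: hom_eq. Qed.
Lemma endo_1mul : right_id (hom_id A) endo_mul.
Proof. by move=> e; exact: hom_eq. Qed.

HB.instance Definition _ :=
  isMonoid.Build endo endo_mulA endo_mul1 endo_1mul.

Definition endo_monoid : monoidType := endo.

End EndomorphismMonoid.

Section HomFunctor.
Context (M : monoidType) (A : ract M).
Local Notation E := (endo_monoid A).

Definition hom_act (X : ract M) : ract E.
Proof.
exists (hom A X) (fun f (e : E) => hom_comp f (e : hom A A)).
- by move=> f e e'; exact: hom_eq.
- by move=> f; exact: hom_eq.
Defined.

Definition hom_act_map (X X' : ract M) (g : hom X X') :
  hom (hom_act X) (hom_act X').
Proof.
exists (fun f : hom A X => hom_comp g f : hom_act X').
by move=> f e; exact: hom_eq.
Defined.

Definition H_ : functor M E.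
Proof.
exists hom_act hom_act_map.
- by move=> X; apply: hom_eq => f; exact: hom_eq.
- by move=> X X' X'' g f; apply: hom_eq => h; exact: hom_eq.
Defined.

End HomFunctor.

Section Tensor.
Context (M : monoidType) (A : ract M).
Local Notation E := (endo_monoid A).

Section Object.
Context (Y : ract E).

Inductive tensor_step : Y * A -> Y * A -> Prop :=
| TensorStep (y : Y) (e : E) (a : A) :
    tensor_step (y *| e, a) (y, (e : hom A A) a).

Definition tensor_rel : Y * A -> Y * A -> Prop :=
  clos_refl_sym_trans (Y * A) tensor_step.

Definition tensor_eq (p q : {classic Y * A}) : bool := `[< tensor_rel p q >].

Lemma tensor_eq_refl : reflexive tensor_eq.
Proof. by move=> p; apply/asboolP; exact: rst_refl. Qed.
Lemma tensor_eq_sym : symmetric tensor_eq.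
Proof.
by move=> p q; apply/asboolP/asboolP => pq; exact: rst_sym.
Qed.
Lemma tensor_eq_trans : transitive tensor_eq.
Proof.
move=> q p r /asboolP pq /asboolP qr; apply/asboolP; exact: rst_trans pq qr.
Qed.

Canonical tensor_equiv :=
  EquivRel tensor_eq tensor_eq_refl tensor_eq_sym tensor_eq_trans.

Definition tensor : Type := {eq_quot tensor_eq}%qT.

Definition tens (y : Y) (a : A) : tensor :=
  (\pi_({eq_quot tensor_eq}) ((y, a) : {classic Y * A}))%qT.

Definition tensor_repr (t : tensor) : Y * A :=
  repr (t : {eq_quot tensor_eq}%qT).

Lemma tensor_reprK (t : tensor) : tens (tensor_repr t).1 (tensor_repr t).2 = t.
Proof. by rewrite /tens -surjective_pairing; exact: reprK. Qed.

Lemma tensP (y y' : Y) (a a' : A) :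
  tens y a = tens y' a' <-> tensor_rel (y, a) (y', a').
Proof.
have eqP := @eqmodP _ tensor_equiv (y, a) (y', a').
by split=> [/eqP/asboolP | /asboolP/eqP].
Qed.

(* [f] factors through the quotient as soon as it is constant on generators. *)
Definition tensor_lift (B : Type) (f : Y -> A -> B) (t : tensor) : B :=
  f (tensor_repr t).1 (tensor_repr t).2.

Lemma tensor_liftE (B : Type) (f : Y -> A -> B) :
  (forall (y : Y) (e : E) a, f (y *| e) a = f y ((e : hom A A) a)) ->
  forall y a, tensor_lift f (tens y a) = f y a.
Proof.
move=> fe y a; rewrite /tensor_lift.
have : tensor_rel (tensor_repr (tens y a)) (y, a).
  by rewrite [tensor_repr _]surjective_pairing -tensP tensor_reprK.
rewrite -[in f y a]/((y, a).1) -[X in _ = f _ X]/((y, a).2).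
elim=> [p q []//|//|p q _ ->//|p q r _ -> _ ->//].
Qed.

Lemma tens_endo (y : Y) (e : E) (a : A) :
  tens (y *| e) a = tens y ((e : hom A A) a).
Proof. by apply/tensP; apply: rst_step; constructor. Qed.

Lemma tensor_ind (P : tensor -> Prop) :
  (forall y a, P (tens y a)) -> forall t, P t.
Proof. by move=> Pt t; rewrite -(tensor_reprK t); exact: Pt. Qed.

Definition tensor_mul (t : tensor) (m : M) : tensor :=
  tensor_lift (fun y a => tens y (a *| m)) t.

Lemma tensor_mulE (y : Y) (a : A) (m : M) :
  tensor_mul (tens y a) m = tens y (a *| m).
Proof.
by apply: (tensor_liftE (f := fun y a => tens y (a *| m))) => ? e ?;
  rewrite tens_endo homM.
Qed.

Definition tensor_act : ract M.
Proof.
exists tensor tensor_mul.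
- by move=> t m m'; elim/tensor_ind: t => y a; rewrite !tensor_mulE actM.
- by move=> t; elim/tensor_ind: t => y a; rewrite tensor_mulE act1.
Defined.

Lemma tens_act (y : Y) (a : A) (m : M) :
  tens y (a *| m) = (tens y a : tensor_act) *| m.
Proof. by rewrite /= tensor_mulE. Qed.

End Object.

Lemma tens_hom_endo (Y Y' : ract E) (g : hom Y Y') :
  forall (y : Y) (e : E) (a : A),
    tens (g (y *| e)) a = tens (g y) ((e : hom A A) a).
Proof. by move=> y e a; rewrite homM tens_endo. Qed.

Definition tensor_map (Y Y' : ract E) (g : hom Y Y') :
  hom (tensor_act Y) (tensor_act Y').
Proof.
exists (tensor_lift (fun y a => tens (g y) a) : tensor_act Y -> tensor_act Y').
move=> t m; elim/tensor_ind: t => y a.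
by rewrite -tens_act !(tensor_liftE (tens_hom_endo g)) tens_act.
Defined.

Lemma tensor_mapE (Y Y' : ract E) (g : hom Y Y') (y : Y) (a : A) :
  tensor_map g (tens y a) = tens (g y) a.
Proof. exact: (tensor_liftE (tens_hom_endo g)). Qed.

Definition T_ : functor E M.
Proof.
exists tensor_act tensor_map.
- by move=> Y; apply: hom_eq => t; elim/tensor_ind: t => y a; rewrite tensor_mapE.
- move=> Y Y' Y'' g f; apply: hom_eq => t; elim/tensor_ind: t => y a.
  by rewrite -[RHS]/(tensor_map g (tensor_map f (tens y a))) !tensor_mapE.
Defined.

End Tensor.

Section Adjunction.
Context (M : monoidType) (A : ract M).
Local Notation E := (endo_monoid A).
Local Notation H := (H_ A).
Local Notation T := (T_ A).

Definition delta_comp (X : ract M) : hom (T (H X)) X.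
Proof.
exists (tensor_lift (fun (f : H X) a => (f : hom A X) a) : T (H X) -> X).
move=> t m; elim/tensor_ind: t => f a.
by rewrite -tens_act !tensor_liftE // homM.
Defined.

Lemma delta_compE (X : ract M) (f : H X) (a : A) :
  delta_comp X (tens f a) = (f : hom A X) a.
Proof. exact: (tensor_liftE (f := fun (f : H X) a => (f : hom A X) a)). Qed.

Definition delta : nat_trans (functor_comp T H) (functor_id M).
Proof.
exists delta_comp => X X' f; apply: hom_eq => t; elim/tensor_ind: t => g a.
rewrite -[LHS]/(delta_comp X' (tensor_map (hom_act_map A f) (tens g a))).
by rewrite -[RHS]/(f (delta_comp X (tens g a))) tensor_mapE !delta_compE.
Defined.

Definition eta_fun (Y : ract E) (y : Y) : H (T Y) :=
  @Hom M A (T Y) (fun a => tens y a) (tens_act y).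

Definition eta_comp (Y : ract E) : hom Y (H (T Y)).
Proof.
exists (@eta_fun Y) => y e.
by apply: hom_eq => a; exact: tens_endo.
Defined.

Definition eta : nat_trans (functor_id E) (functor_comp H T).
Proof.
exists eta_comp => Y Y' f; apply: hom_eq => y; apply: hom_eq => a.
exact/esym/(tensor_mapE f y a).
Defined.

Lemma triangle_T (Y : ract E) :
  hom_comp (delta (T Y)) (fmap T (eta Y)) = hom_id (T Y).
Proof.
apply: hom_eq => t; elim/tensor_ind: t => y a.
rewrite -[LHS]/(delta_comp _ (tensor_map (eta_comp Y) (tens y a))).
by rewrite tensor_mapE delta_compE.
Qed.

Lemma triangle_H (X : ract M) :
  hom_comp (fmap H (delta X)) (eta (H X)) = hom_id (H X).
Proof.
by apply: hom_eq => f; apply: hom_eq => a; exact: (delta_compE f a).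
Qed.

End Adjunction.

Section Subcategories.
Context (M : monoidType) (A : ract M).
Local Notation E := (endo_monoid A).
Local Notation H := (H_ A).
Local Notation T := (T_ A).

Definition C_sub (X : ract M) : Prop :=
  forall (U V : ract M) (eps : hom U V), is_iso (fmap H eps) ->
    bijective (fun f : hom X U => hom_comp eps f).

Definition G_sub (X : ract M) : Prop := is_epi (delta A X).

Definition G_sup (Y : ract E) : Prop := is_mono (eta A Y).

Definition S_sup (Y : ract E) : Prop := is_iso (eta A Y).

Definition star_act : Prop := quasi_inverse_on G_sub G_sup H T.

Definition weak_self_projective : Prop :=
  forall (U Y : ract E) (g : hom U Y),
    is_epi g -> S_sup U -> is_epi (fmap (functor_comp H T) g).

Definition is_subact (B : set A) : Prop := forall a m, B a -> B (a *| m).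

Local Open Scope classical_set_scope.

Definition decomposable : Prop :=
  exists B C : set A,
    [/\ is_subact B, is_subact C, B !=set0, C !=set0 &
        setT = B `|` C /\ B `&` C = set0].

(* The empty act counts as indecomposable here; it is a counterexample to
   [weak_self_projective A] and [C_sub A] = [G_sub A] implying [star_act A],
   whence the separate assumption [inhabited A] in the theorem. *)
Definition indecomposable : Prop := ~ decomposable.

End Subcategories.

(* Main.v *)
(** Since [T Y] lies in [G_A] and [H X] in [G^A] for all [Y] and [X], an
    abstract pair of quasi-inverse equivalences between [G_A] and [G^A] forces
    [delta] and [eta] to be isomorphisms there.  For (a), [Y] and the image of
    [eta_Y], which lies in [G^A], have the same tensor product with [A], and
    [C_A] always contains the acts [T Y].  For (b), indecomposability makes free
    [E]-acts objects of [S^A]; covering [Y] by a free act, weak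
    self-projectivity makes [eta_Y] surjective for every [Y].  Hence
    [H delta_X] is always invertible, and [G_A] being contained in [C_A] lets
    one invert [delta_X] itself. *)
Require Import Defs.
From mathcomp Require Import all_boot.
From mathcomp Require Import boolp classical_sets.

Set Implicit Arguments.
Unset Strict Implicit.
Unset Printing Implicit Defensive.
Local Open Scope act_scope.

Definition surj (X Y : Type) (f : X -> Y) : Prop := forall y, exists x, f x = y.

(** * Epimorphisms, monomorphisms and images of acts *)

Section Acts.
Context (M : monoidType).
Implicit Types X Y Z : ract M.

Lemma hom_congr X Y (f g : hom X Y) : f = g -> f =1 g.
Proof. by move=> ->. Qed.

Lemma surj_epi X Y (f : hom X Y) : surj f -> is_epi f.
Proof.
move=> fs Z g h gh; apply: hom_eq => y; have [x <-] := fs y.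
exact: (hom_congr gh).
Qed.

(* The cofree act on [Prop]: morphisms into it are predicates. *)
Definition cofree : ract M.
Proof.
exists (M -> Prop) (fun p m k => p (m * k)%g).
- by move=> p m m'; apply/funext => k; rewrite mulgA.
- by move=> p; apply/funext => k; rewrite mul1g.
Defined.

Definition cofree_hom X (P : X -> Prop) : hom X cofree.
Proof.
exists (fun x => (fun m => P (x *| m)) : cofree) => x m.
by apply/funext => k /=; rewrite actM.
Defined.

(** The image of [f] is closed under the action, so membership in it and the constant predicate
    [True] give two morphisms to [cofree] that agree after [f]. *)
Lemma epi_surj X Y (f : hom X Y) : is_epi f -> surj f.
Proof.
move=> fe.
have H : cofree_hom (fun y => exists x, f x = y) = cofree_hom (fun=> True).
  apply: fe; apply: hom_eq => x; apply/funext => m /=; apply/propext; split=> // _.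
  by exists (x *| m); rewrite homM.
move=> y; have := congr1 (fun p : M -> Prop => p 1%g) (hom_congr H y).
by rewrite /= act1 => ->.
Qed.

Lemma inj_mono X Y (f : hom X Y) : injective f -> is_mono f.
Proof.
move=> fi Z g h gh; apply: hom_eq => z; apply: fi.
exact: (hom_congr gh).
Qed.

Definition free_act (I : Type) : ract M.
Proof.
exists (I * M)%type (fun p m => (p.1, (p.2 * m)%g)).
- by move=> p m m' /=; rewrite mulgA.
- by move=> [i k] /=; rewrite mulg1.
Defined.

Definition free_hom (I : Type) X (f : I -> X) : hom (free_act I) X.
Proof.
exists (fun p : I * M => f p.1 *| p.2).
by move=> p m /=; rewrite actM.
Defined.

(** Elements of [X] are tested as morphisms from the free act on one generator. *)
Lemma mono_inj X Y (f : hom X Y) : is_mono f -> injective f.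
Proof.
move=> fm x x' fx.
have H : free_hom (fun _ : unit => x) = free_hom (fun=> x').
  by apply: fm; apply: hom_eq => p /=; rewrite !homM fx.
by have := hom_congr H (tt, 1%g); rewrite /= !act1.
Qed.

Lemma iso_inj X Y (f : hom X Y) : is_iso f -> injective f.
Proof. by case=> g [/hom_congr gf _]; exact: (can_inj (g := g) gf). Qed.

Lemma iso_surj X Y (f : hom X Y) : is_iso f -> surj f.
Proof. by case=> g [_ /hom_congr fg] y; exists (g y); exact: fg. Qed.

Lemma bij_iso X Y (f : hom X Y) : injective f -> surj f -> is_iso f.
Proof.
move=> fi /choice[g gK].
have gM y m : g (y *| m) = g y *| m by apply: fi; rewrite homM !gK.
exists (Hom gM); split; apply: hom_eq => x /=; last exact: gK.
by apply: fi; rewrite gK.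
Qed.

Section Image.
Context (X Y : ract M) (f : hom X Y).

Lemma image_subact (y : Y) m :
  (exists x, f x = y) -> exists x, f x = y *| m.
Proof. by case=> x <-; exists (x *| m); exact: homM. Qed.

Definition image_act : ract M.
Proof.
exists {y : Y | exists x, f x = y}
  (fun y m => exist _ (sval y *| m) (image_subact m (svalP y))).
- by move=> y m m'; apply: eq_exist; rewrite /= actM.
- by move=> [y yf]; apply: eq_exist; rewrite /= act1.
Defined.

Definition image_incl : hom image_act Y.
Proof. by exists (fun y : image_act => sval y) => y m. Defined.

Definition image_proj : hom X image_act.
Proof.
exists (fun x => exist _ (f x) (ex_intro _ x erefl) : image_act) => x m.
by apply: eq_exist; exact: homM.
Defined.

Lemma image_incl_inj : injective image_incl.
Proof. by move=> [y py] [y' py'] /= yy'; exact: eq_exist. Qed.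

Lemma image_proj_surj : surj image_proj.
Proof. by move=> [y [x xy]]; exists x; exact: eq_exist. Qed.

End Image.

End Acts.

(** * The adjunction between [T] and [H] *)

Section Adjunction.
Context (M : monoidType) (A : ract M).
Local Notation E := (endo_monoid A).
Local Notation H := (H_ A).
Local Notation T := (T_ A).

Lemma fmap_TE (Y Y' : ract E) (g : hom Y Y') y a :
  fmap T g (tens y a) = tens (g y) a.
Proof. exact: tensor_mapE. Qed.

Lemma deltaE (X : ract M) (f : H X) (a : A) :
  delta A X (tens f a) = (f : hom A X) a.
Proof. exact: delta_compE. Qed.

Lemma transposeE (Y : ract E) (X : ract M) (h : hom Y (H X)) y a :
  hom_comp (delta A X) (fmap T h) (tens y a) = (h y : hom A X) a.
Proof. by rewrite -[LHS]/(delta A X (fmap T h (tens y a))) fmap_TE deltaE. Qed.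

Lemma T_hom_eq (Y : ract E) (X : ract M) (f g : hom (T Y) X) :
  (forall y a, f (tens y a) = g (tens y a)) -> f = g.
Proof. by move=> fg; apply: hom_eq => t; elim/tensor_ind: t. Qed.

Lemma T_G_sub (Y : ract E) : G_sub A (T Y).
Proof.
apply: surj_epi => t; exists (fmap T (eta A Y) t).
exact: (hom_congr (triangle_T Y)).
Qed.

Lemma eta_H_inj (X : ract M) : injective (eta A (H X)).
Proof.
apply: (can_inj (g := fmap H (delta A X))).
exact: (hom_congr (triangle_H A X)).
Qed.

Lemma H_G_sup (X : ract M) : G_sup (H X).
Proof. exact/inj_mono/eta_H_inj. Qed.

Lemma sub_H_G_sup (X : ract M) (Y : ract E) (j : hom Y (H X)) :
  injective j -> G_sup Y.
Proof.
move=> ji; apply: inj_mono => y y' yy'; apply/ji/eta_H_inj.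
have /hom_congr n := naturality (eta A) j.
exact: etrans (n y) (etrans (congr1 (fmap (functor_comp H T) j) yy') (esym (n y'))).
Qed.

(** By a triangle identity [eta A (H X)] is a section of [fmap H (delta A X)]; a surjective section
    is a two-sided inverse. *)
Lemma H_delta_iso (X : ract M) :
  surj (eta A (H X)) -> is_iso (fmap H (delta A X)).
Proof.
have /hom_congr hd := triangle_H A X => es.
exists (eta A (H X)); split; last exact: hom_eq.
by apply: hom_eq => f; have [g <-] := es f; congr (eta_comp _ _); exact: hd.
Qed.

(** Under the adjunction, composing morphisms out of [T Y] with [eps] becomes composing morphisms
    out of [Y] with the invertible [fmap H eps]. The inverse transposes [g], composes with [k] and
    transposes back. *)
Lemma T_C_sub (Y : ract E) : C_sub A (T Y).
Proof.
move=> U V eps [k [/hom_congr kK /hom_congr Kk]].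
exists (fun g : hom (T Y) V =>
  hom_comp (delta A U) (fmap T (hom_comp k (hom_comp (fmap H g) (eta A Y))))).
- move=> f; apply: T_hom_eq => y a; rewrite transposeE.
  have -> : hom_comp k (hom_comp (fmap H (hom_comp eps f)) (eta A Y))
          = hom_comp (fmap H f) (eta A Y).
    rewrite fmap_comp; apply: hom_eq => z; exact: kK.
  by [].
- move=> g; apply: T_hom_eq => y a.
  rewrite -[LHS]/(eps (hom_comp _ _ (tens y a : T Y))) transposeE.
  exact: (hom_congr (Kk (fmap H g (eta A Y y)) : _ = _ :> hom A V)).
Qed.

Lemma C_sub_iso (X X' : ract M) (f : hom X X') :
  is_iso f -> C_sub A X -> C_sub A X'.
Proof.
move=> [g [_ /hom_congr fg]] CX U V eps /CX[k kK Kk].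
exists (fun h => hom_comp (k (hom_comp h f)) g) => h.
- have -> : hom_comp (hom_comp eps h) f = hom_comp eps (hom_comp h f).
    exact: hom_eq.
  by rewrite kK; apply: hom_eq => x /=; rewrite [f _]fg.
- apply: hom_eq => x; rewrite -[LHS]/(hom_comp eps (k (hom_comp h f)) (g x)).
  by rewrite Kk /= [f _]fg.
Qed.

Lemma delta_iso_quasi_inverse :
  (forall X, G_sub A X -> is_iso (delta A X)) ->
  (forall Y, G_sup Y -> is_iso (eta A Y)) -> star_act A.
Proof.
move=> deltaI etaI; split=> [X _|Y _||]; [exact: H_G_sup|exact: T_G_sub| |].
- exists (fun X _ => delta A X); split=> // X X' _ _ f; exact: naturality.
(* The isomorphism must go from [H (T Y)] to [Y], so inverses of [eta] are chosen. *)
- have ex (Y : ract E) (GY : G_sup Y) :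
    {k : hom (H (T Y)) Y | hom_comp k (eta A Y) = hom_id Y /\
                            hom_comp (eta A Y) k = hom_id _}.
    by apply: cid; exact: etaI.
  exists (fun Y GY => sval (ex Y GY)); split=> [Y GY|Y Y' GY GY' f].
    by have [k1 k2] := svalP (ex Y GY); exists (eta A Y).
  have [_ /hom_congr Kk] := svalP (ex Y GY).
  have [/hom_congr kK' _] := svalP (ex Y' GY').
  have /hom_congr n := naturality (eta A) f.
  apply: hom_eq => u; set k' := sval (ex Y' GY') in kK' *.
  apply: etrans (congr1 (hom_comp k' (fmap (functor_comp H T) f)) (esym (Kk u))) _.
  exact: etrans (congr1 k' (esym (n _))) (kK' _).
Qed.

(** * Consequences of being a $*$-act *)

Section Star.
Hypothesis star : star_act A.

Lemma star_H_faithful (X X' : ract M) (f g : hom X X') :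
  G_sub A X -> G_sub A X' -> fmap H f = fmap H g -> f = g.
Proof.
move=> GX GX' fg; case: star => _ _ [phi [phiI phiN]] _.
have n h := hom_congr (phiN X X' GX GX' h).
apply: hom_eq => x; have [t <-] := iso_surj (phiI X GX) x.
have fgt := congr1 (fun h => phi X' GX' (fmap T h t)) fg.
exact: etrans (esym (n f t)) (etrans fgt (n g t)).
Qed.

(** The preimage is [fmap H h] conjugated by the given isomorphism [phi]. Naturality of [phi] yields
    [fmap H (fmap T g) = fmap H h], and [H] is faithful on [G_sub]. *)
Lemma star_T_full (Y Y' : ract E) (h : hom (T Y) (T Y')) :
  G_sup Y -> G_sup Y' -> exists g : hom Y Y', fmap T g = h.
Proof.
move=> GY GY'; case: star => _ _ _ [phi [phiI phiN]].
have [k [kK Kk]] := phiI Y GY.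
exists (hom_comp (phi Y' GY') (hom_comp (fmap H h) k)).
apply: star_H_faithful; [exact: T_G_sub..|].
apply: hom_eq => u; apply: (iso_inj (phiI Y' GY')).
apply: etrans (hom_congr (phiN Y Y' GY GY' _) u) _.
exact: (congr1 (fun v => phi Y' GY' (fmap H h v)) (hom_congr kK u)).
Qed.

(** By fullness [delta A (T Y)] is [fmap T g] for some [g]; naturality of [eta] and a triangle
    identity make [g] a right inverse of [eta A Y]. *)
Lemma star_eta_iso (Y : ract E) : G_sup Y -> is_iso (eta A Y).
Proof.
move=> GY; apply: bij_iso; first exact: mono_inj.
have [g gE] := star_T_full (delta A (T Y)) (@H_G_sup (T Y)) GY.
move=> u; exists (g u).
have /hom_congr n := naturality (eta A) g.
apply: etrans (n u) _; rewrite -[LHS]/(fmap H (fmap T g) (eta A (H (T Y)) u)) gE.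
exact: (hom_congr (triangle_H A (T Y))).
Qed.

Lemma star_H_delta_iso (X : ract M) : is_iso (fmap H (delta A X)).
Proof. exact/H_delta_iso/iso_surj/star_eta_iso/H_G_sup. Qed.

Lemma star_delta_iso (X : ract M) : G_sub A X -> is_iso (delta A X).
Proof.
move=> GX; have [s [sK Ks]] := star_H_delta_iso X.
apply: bij_iso; last exact: epi_surj.
case: star => _ _ [phi [phiI phiN]] _.
have GT := @T_G_sub (H X).
(* Naturality of [phi] at [delta A X] reduces its injectivity to that of
   [fmap T (fmap H (delta A X))], which has the left inverse [fmap T s]. *)
have /hom_congr n := phiN _ _ GT GX (delta A X).
move=> t t'.
have [u <-] := iso_surj (phiI _ GT) t; have [u' <-] := iso_surj (phiI _ GT) t'.
move=> uu'; congr (phi _ _ _).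
have /(iso_inj (phiI _ GX)) := etrans (n u) (etrans uu' (esym (n u'))).
move=> /(congr1 (fmap T s)).
have TK v : fmap T s (fmap T (fmap H (delta A X)) v) = v.
  rewrite -[LHS]/(hom_comp (fmap T s) (fmap T (fmap H (delta A X))) v).
  by rewrite -fmap_comp sK fmap_id.
by move=> e; rewrite -(TK u) -(TK u'); exact: e.
Qed.

Lemma star_C_sub (X : ract M) : C_sub A X <-> G_sub A X.
Proof.
split=> [CX | GX]; last exact: C_sub_iso (star_delta_iso GX) (T_C_sub _).
(* Lifting the identity of [X] through [delta A X] splits it. *)
have [k _ /(_ (hom_id X)) /hom_congr kK] := CX _ _ _ (star_H_delta_iso X).
by apply: surj_epi => x; exists (k (hom_id X) x); exact: kK.
Qed.

Lemma star_weak_self_projective : weak_self_projective A.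
Proof.
move=> U Y g /epi_surj gs SU; apply: surj_epi => z.
pose q := image_proj (eta A Y); pose j := image_incl (eta A Y).
have qs : surj q by exact: image_proj_surj.
have GI : G_sup (image_act (eta A Y)).
  exact: sub_H_G_sup (image_incl_inj (f := eta A Y)).
(* Since [eta A Y] is [j] after [q], a triangle identity gives [fmap T q] a left inverse. Equality
   with [z] can thus be tested over the image, where [eta] is invertible. *)
have Tqi : injective (fmap T q).
  apply: (can_inj (g := hom_comp (delta A (T Y)) (fmap T j))) => t.
  have /hom_congr tr := triangle_T Y.
  rewrite -[RHS]tr.
  have jq : hom_comp j q = eta A Y by exact: hom_eq.
  have /hom_congr Tjq := etrans (esym (fmap_comp T j q)) (congr1 (fmap T) jq).
  exact: (congr1 (delta A (T Y)) (Tjq t)).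
have [w wz] := iso_surj (star_eta_iso GI) (fmap H (fmap T q) z).
have [y yw] := qs w; have [u uy] := gs y.
exists (eta A U u); apply: hom_eq => a; apply: Tqi.
rewrite -[RHS]/((fmap H (fmap T q) z : hom A _) a) -wz -yw -uy.
exact: etrans (congr1 (fmap T q) (fmap_TE g u a)) (fmap_TE q (g u) a).
Qed.

End Star.

(** * Free acts when [A] is non-empty and indecomposable *)

Section Indecomposable.
Hypotheses (a0 : A) (indec : indecomposable A).

(** Otherwise the fibre of [p] through [a0] and its complement would decompose [A]. *)
Lemma indecomposable_constant (I : Type) (p : A -> I) :
  (forall a m, p (a *| m) = p a) -> forall a, p a = p a0.
Proof.
move=> pM a; apply: contrapT => pa; apply: indec.
exists [set b | p b = p a0]%classic, [set b | p b <> p a0]%classic; split.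
- by move=> b m /=; rewrite pM.
- by move=> b m /=; rewrite pM.
- by exists a0.
- by exists a.
- split; apply/seteqP; split=> b //=; last by case.
  by move=> _; exact: EM.
Qed.

Section Free.
Context (I : Type).
Local Notation F := (free_act E I).

(** This and [tens_free_point] are the two coordinates of the isomorphism from [T F] to [I * A], a
    disjoint union of copies of [A]. *)
Definition tens_free_index : T F -> I := tensor_lift (fun (x : F) (_ : A) => x.1).

Lemma tens_free_indexE (x : F) a : tens_free_index (tens x a) = x.1.
Proof. exact: (tensor_liftE (f := fun (x : F) (_ : A) => x.1)). Qed.

Definition tens_free_point : hom (T F) A.
Proof.
exists (tensor_lift (fun (x : F) a => (x.2 : hom A A) a) : T F -> A).
move=> t m; elim/tensor_ind: t => y a.
by rewrite -tens_act !tensor_liftE // homM.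
Defined.

Lemma tens_free_pointE (x : F) a :
  tens_free_point (tens x a) = (x.2 : hom A A) a.
Proof. exact: (tensor_liftE (f := fun (x : F) a => (x.2 : hom A A) a)). Qed.

Lemma tens_freeE (t : T F) :
  t = tens ((tens_free_index t, 1%g) : F) (tens_free_point t).
Proof.
elim/tensor_ind: t => -[i e] a; rewrite tens_free_indexE tens_free_pointE /=.
by rewrite -tens_endo /= mul1g.
Qed.

(** A morphism from [A] to [I * A] has constant index, so it amounts to an index and an endomorphism
    of [A], that is, an element of [F]. The point [a0] is where the index is read off. *)
Lemma free_S_sup : S_sup F.
Proof.
apply: bij_iso => [[i e] [i' e'] ee' | f].
- have ea a : tens ((i, e) : F) a = tens ((i', e') : F) a := hom_congr ee' a.
  have := congr1 tens_free_index (ea a0); rewrite !tens_free_indexE /= => ->.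
  congr pair; apply: hom_eq => a.
  by have := congr1 tens_free_point (ea a); rewrite !tens_free_pointE.
- have idx a : tens_free_index ((f : hom A _) a)
             = tens_free_index ((f : hom A _) a0).
    apply: (indecomposable_constant (p := fun a => tens_free_index (f a))).
    move=> b m; rewrite homM; move: (hom_fun f b) => t.
    by elim/tensor_ind: t => x c; rewrite -tens_act !tens_free_indexE.
  exists (tens_free_index ((f : hom A _) a0), hom_comp tens_free_point f).
  apply: hom_eq => a; rewrite [RHS]tens_freeE idx.
  rewrite -[tens_free_point _]/(hom_comp tens_free_point f a).
  by rewrite -[RHS]tens_endo /= mul1g.
Qed.

End Free.

Lemma weak_self_projective_eta_surj :
  weak_self_projective A -> forall Y, surj (eta A Y).
Proof.
move=> wsp Y u; pose g := free_hom (M := E) (@id Y).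
have gs : surj g by move=> y; exists (y, 1%g); exact: act1.
have [v <-] := epi_surj (wsp _ _ g (surj_epi gs) (free_S_sup Y)) u.
have [x <-] := iso_surj (free_S_sup Y) v.
by exists (g x); exact: (hom_congr (naturality (eta A) g)).
Qed.

End Indecomposable.

Lemma eta_surj_star :
  (forall Y, surj (eta A Y)) -> (forall X, G_sub A X -> C_sub A X) ->
  star_act A.
Proof.
move=> etaS GC; apply: delta_iso_quasi_inverse => [X GX | Y GY]; last first.
  by apply: bij_iso => //; exact: mono_inj.
have Hd := H_delta_iso (etaS (H X)).
have [k _ /(_ (hom_id X)) dk] := GC X GX _ _ _ Hd.
exists (k (hom_id X)); split=> //.
(* The right inverse of [delta A X] is also a left one: [T (H X)] lies in [C_sub], so [delta A X]
   can be cancelled on the left. *)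
apply: (bij_inj (@T_C_sub (H X) _ _ _ Hd)); apply: hom_eq => t.
exact: (hom_congr dk (delta A X t)).
Qed.

End Adjunction.

Theorem theorem5p3 (M : monoidType) (A : ract M) :
  (star_act A -> weak_self_projective A /\ (forall X, C_sub A X <-> G_sub A X)) /\
  (inhabited A ->
   indecomposable A -> weak_self_projective A -> (forall X, C_sub A X <-> G_sub A X) ->
   star_act A).
Proof.
split=> [star | [a0] indec wsp CG].
  by split; [exact: star_weak_self_projective | exact: star_C_sub].
apply: eta_surj_star => [|X]; first exact: weak_self_projective_eta_surj.
by rewrite CG.
Qed.
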